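(* Let $\mathcal{Q}=\mathcal{Q}(C)$ be a covering polyhedron and let $\mathcal{F}=\{I_n\}_{n=0}^\infty$ be its associated filtration. Then there exists an integer $k\geq 1$ such that $\widehat{\alpha}(\mathcal{F})=\dfrac{\alpha_{\mathcal{F}}(nk)}{nk}$ for all $n\geq 1$.
   Context: $S=K[t_1,\ldots,t_s]$ is a polynomial ring over a field $K$, $\mathbb{N}=\{0,1,\ldots\}$, $t^a=t_1^{a_1}\cdots t_s^{a_s}$ for $a\in\mathbb{N}^s$; vector inequalities are componentwise and $1$ also denotes $(1,\ldots,1)$. A covering polyhedron is a polyhedron $\mathcal{Q}(C)=\{x\in\mathbb{R}^s\mid x\geq 0;\ xC\geq 1\}$ ($x$ a row vector), where $C$ is an $s\times m$ matrix with non-negative rational entries and non-zero columns. Its associated filtration is $I_0=S$ and, for $n\geq 1$, $I_n$ the ideal generated by all monomials $t^a$, $a\in\mathbb{N}^s$, with $a/n\in\mathcal{Q}(C)$. For $n\geq 1$, $\alpha_{\mathcal{F}}(n)$ is the least degree of a monomial in $I_n$, and the Waldschmidt constant of $\mathcal{F}$ is $\widehat{\alpha}(\mathcal{F})=\lim_{n\to\infty}\alpha_{\mathcal{F}}(n)/n$ (this limit exists and equals $\inf_{n\geq 1}\alpha_{\mathcal{F}}(n)/n$). *)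

(* Defs.v *)
From HB Require Import structures.
From mathcomp Require Import all_boot all_order all_algebra.
(* multinomials must be imported before MathComp-Analysis: in the other order
   the notation levels of the two libraries clash. *)
From mathcomp Require Import mpoly.
From mathcomp Require Import all_classical all_reals all_analysis.
Import Order.TTheory GRing.Theory Num.Theory.
Import numFieldNormedType.Exports.
Set Implicit Arguments.
Unset Strict Implicit.
Unset Printing Implicit Defensive.
Local Open Scope classical_set_scope.
Local Open Scope ring_scope.

Definition covering_polyhedron (R : realType) (s m : nat) (C : 'M[rat]_(s, m))
    : set 'rV[R]_s :=
  [set x : 'rV[R]_s | (forall i, 0 <= x 0 i) /\
                      (forall j, 1 <= (x *m map_mx ratr C) 0 j)].

(* Unlike idealr_closed, this allows the unit ideal. *)
Definition is_ideal (S : comNzRingType) (I : set S) : Prop :=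
  [/\ I 0, forall p q, I p -> I q -> I (p + q)
    & forall a p, I p -> I (a * p)].

Definition ideal_gen (S : comNzRingType) (A : set S) : set S :=
  smallest (@is_ideal S) A.

Definition filtration (R : realType) (K : fieldType) (s m : nat)
    (C : 'M[rat]_(s, m)) (n : nat) : set {mpoly K[s]} :=
  if n is 0%N then setT
  else ideal_gen [set 'X_[K, a] | a in
    [set a : 'X_{1..s} |
      covering_polyhedron C (\row_i ((a i)%:R / n%:R) : 'rV[R]_s)]].
Arguments filtration R K {s m} C n.

Definition monomial_degrees (K : fieldType) (s : nat)
    (I : set {mpoly K[s]}) : set nat :=
  [set mdeg a | a in [set a : 'X_{1..s} | I 'X_[a]]].

(* The default value 0 of xget is used only if F n contains no monomial. *)
Definition alpha (K : fieldType) (s : nat)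
    (F : nat -> set {mpoly K[s]}) (n : nat) : nat :=
  xget 0%N [set d | monomial_degrees (F n) d /\
    forall e, monomial_degrees (F n) e -> (d <= e)%N].

Definition waldschmidt (R : realType) (K : fieldType) (s : nat)
    (F : nat -> set {mpoly K[s]}) : R :=
  limn (fun n => (alpha F n)%:R / n%:R : R).

(* Main.v *)
Require Import Defs.
From mathcomp Require Import all_boot all_order all_algebra.
From mathcomp Require Import mpoly.
From mathcomp Require Import all_classical all_reals all_analysis.
From mathcomp Require Import lra.

(** Write |x| for the sum of the coordinates of x.  Since C has non-negative
    entries, Q(C) is closed under increasing coordinates, so the monomials of
    I_n are exactly the t^a with a/n in Q(C); no further monomials enter when
    the ideal is generated.  Hence alpha(n)/n is the minimum of |y| over those
    y in Q(C) of the form a/n.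

    The key point is that the linear program of minimizing |y| over Q(C) has a
    rational minimizer x, because C is rational.  Linear programming makes
    sense over any ordered field, so the minimum is taken directly over the
    rationals ([linear_program_min]); only rational points a/n ever have to be
    compared with it.  Attainment is obtained by Fourier-Motzkin elimination
    ([polyhedral_cone_eliminate]): projecting the epigraph of the objective to
    the objective axis leaves finitely many inequalities in one variable, and a
    non-empty set on a line given that way and bounded below has a least
    element.

    Put v = |x|.  Then alpha(n)/n >= v for all n >= 1, while rounding n x up
    gives a monomial of I_n of degree at most n v + s ([alpha_bounds]); so
    alpha(n)/n tends to v.  If k is a common denominator of the coordinates of
    x, then n k x is itself an exponent vector, whose monomial lies in I_(nk)
    and has degree n k v; thus alpha(nk)/(nk) = v. *)

Import Order.TTheory GRing.Theory Num.Theory.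
Import numFieldNormedType.Exports.
Local Open Scope classical_set_scope.
Local Open Scope ring_scope.

Set Implicit Arguments.
Unset Strict Implicit.

(** * Fourier-Motzkin elimination and attainment in linear programming *)

(** Working with homogeneous inequalities only keeps elimination free of
    constant terms; an affine system is recovered by adding a coordinate that
    is later set to 1. *)
Definition polyhedral_cone (F : realFieldType) (n : nat)
    (P : 'rV[F]_n -> Prop) :=
  exists cs : seq 'cV[F]_n,
    forall x, P x <-> (forall c, c \in cs -> 0 <= (x *m c) 0 0).

Lemma exists_between (F : realFieldType) (ls us : seq F) :
  (forall l u, l \in ls -> u \in us -> l <= u) ->
  exists t, (forall l, l \in ls -> l <= t) /\ (forall u, u \in us -> t <= u).
Proof.
elim: ls => [_|l ls IHls le_lu].
  elim: us => [|u us [t [_ le_t]]]; first by exists 0.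
  exists (Num.min t u); split=> // v; rewrite inE ge_min.
  by case/predU1P=> [->|/le_t ->//]; rewrite lexx orbT.
have [|t [ge_t le_t]] := IHls.
  by move=> l' u l'ls; apply: le_lu; rewrite inE l'ls orbT.
exists (Num.max l t); split=> [l'|u uus].
  by rewrite inE le_max; case/predU1P=> [->|/ge_t ->]; rewrite ?lexx ?orbT.
by rewrite ge_max le_t // le_lu // mem_head.
Qed.

(** Fourier-Motzkin step.  Each inequality [0 <= t * q c + ev y c] bounds the
    variable t from above, from below, or not at all, according to the sign of
    [q c]; a suitable t exists as soon as every lower bound is at most every
    upper bound.  Clearing denominators, this comparison of a pair of bounds is
    again a homogeneous linear inequality in y. *)
Lemma polyhedral_cone_eliminate1 (F : realFieldType) (n : nat)
    (P : 'rV[F]_(1 + n) -> Prop) :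
  polyhedral_cone P ->
  polyhedral_cone (fun y => exists t : 'rV_1, P (row_mx t y)).
Proof.
move=> [cs Pcs].
pose q (c : 'cV[F]_(1 + n)) := usubmx c 0 0.
pose r (c : 'cV[F]_(1 + n)) := dsubmx c.
pose ev (y : 'rV[F]_n) c := (y *m r c) 0 0.
have PE t y : P (row_mx t y) <->
    (forall c, c \in cs -> 0 <= t 0 0 * q c + ev y c).
  have E c : (row_mx t y *m c) 0 0 = t 0 0 * q c + ev y c.
    by rewrite -[c in LHS]vsubmxK mul_row_col mxE [(t *m _) _ _]mxE big_ord1.
  by rewrite Pcs; split=> H c /H; rewrite E.
have evB y c c' : (y *m (q c *: r c' - q c' *: r c)) 0 0 =
    q c * ev y c' - q c' * ev y c.
  rewrite mulmxBr -!scalemxAr /ev.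
  by move: (y *m r c) (y *m r c') => u v; rewrite !mxE.
pose neg := [seq c <- cs | q c < 0]; pose pos := [seq c <- cs | 0 < q c].
exists ([seq r c | c <- cs & q c == 0] ++
        [seq q c *: r c' - q c' *: r c | c <- pos, c' <- neg]).
move=> y; split=> [[t /PE tP] d|yP].
  rewrite mem_cat => /orP[/mapP[c]|/allpairsP[[c c'] /= [+ + ->]]].
    rewrite mem_filter => /andP[/eqP qc0 /tP] /[swap] ->.
    by rewrite qc0 mulr0 add0r.
  rewrite !mem_filter => /andP[qc /tP ccs] /andP[qc' /tP c'cs].
  rewrite evB.
  have := mulr_ge0 (ltW qc) c'cs; have := mulr_le0_ge0 (ltW qc') ccs.
  by nra.
have [|t [ge_t le_t]] := @exists_between F
    [seq - ev y c / q c | c <- pos] [seq - ev y c / q c | c <- neg].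
  move=> _ _ /mapP[c cpos ->] /mapP[c' cneg ->].
  have /yP : q c *: r c' - q c' *: r c \in
      [seq r c | c <- cs & q c == 0] ++
        [seq q c *: r c' - q c' *: r c | c <- pos, c' <- neg].
    rewrite mem_cat; apply/orP; right.
    exact: (allpairs_f (fun c c' => q c *: r c' - q c' *: r c)).
  rewrite evB => le0.
  move: cpos cneg; rewrite !mem_filter => /andP[qc _] /andP[qc' _].
  rewrite ler_pdivrMr // mulrAC ler_ndivlMr //.
  by nra.
exists t%:M; apply/PE => c ccs; rewrite mxE eqxx mulr1n.
have [qc|qc|qc] := ltgtP (q c) 0.
- have /le_t : - ev y c / q c \in [seq - ev y c / q c | c <- neg].
    by apply: (map_f (fun c => - ev y c / q c)); rewrite mem_filter qc.
  by rewrite ler_ndivlMr // -subr_ge0; lra.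
- have /ge_t : - ev y c / q c \in [seq - ev y c / q c | c <- pos].
    by apply: (map_f (fun c => - ev y c / q c)); rewrite mem_filter qc.
  by rewrite ler_pdivrMr //; lra.
- rewrite qc mulr0 add0r; apply: yP; rewrite mem_cat; apply/orP; left.
  by apply: map_f; rewrite mem_filter qc eqxx.
Qed.

Lemma polyhedral_cone_eliminate (F : realFieldType) (d n : nat)
    (P : 'rV[F]_(d + n) -> Prop) :
  polyhedral_cone P ->
  polyhedral_cone (fun y => exists x : 'rV_d, P (row_mx x y)).
Proof.
elim: d P => [|d IHd] P Pcone.
  have [cs csP] := Pcone; exists cs => y; rewrite -csP.
  have E (x : 'rV_0) : row_mx x y = y.
    apply/rowP => i; have -> : i = rshift 0 i by exact/ord_inj.
    by rewrite row_mxEr; congr (y 0 _); apply/ord_inj.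
  by split=> [[x]|Py]; [rewrite E | exists 0; rewrite E].
have [cs csP] := IHd _ (polyhedral_cone_eliminate1 Pcone).
exists cs => y; rewrite -csP.
have E (t : 'rV_1) (x : 'rV_d) :
    row_mx t (row_mx x y) = row_mx (row_mx t x : 'rV_(d.+1)) y.
  rewrite row_mxA; move: (esym _) => e; rewrite (eq_axiomK e); exact: castmx_id.
split=> [[x Px]|[x [t]]].
  exists (rsubmx (x : 'rV_(1 + d))), (lsubmx (x : 'rV_(1 + d))).
  by rewrite E hsubmxK.
by rewrite E => Px; exists (row_mx t x).
Qed.

(** A linear program over an ordered field that is feasible and whose objective
    is bounded below attains its minimum, although bounded sets of such a field
    may lack an infimum: the values t that dominate the objective at some
    feasible point form the projection of a polyhedron, hence are cut out by
    finitely many inequalities in t alone, and the least such t is explicit. *)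
Theorem linear_program_min (F : realFieldType) (d p : nat)
    (A : 'M[F]_(d, p)) (b : 'rV[F]_p) (c : 'cV[F]_d) (z : F) (x0 : 'rV[F]_d) :
    let feasible (x : 'rV_d) := forall j, b 0 j <= (x *m A) 0 j in
    feasible x0 -> (forall x, feasible x -> z <= (x *m c) 0 0) ->
  exists2 x, feasible x & forall y, feasible y -> (x *m c) 0 0 <= (y *m c) 0 0.
Proof.
move=> feasible x0P zP.
(* A vector w is (x, t, u), with u homogenizing the constant terms: at u = 1, P
   says that x is feasible with objective value at most t. *)
pose P (w : 'rV[F]_(d + (1 + 1))) :=
  [/\ (forall j, 0 <= (lsubmx w *m A) 0 j - rsubmx (rsubmx w) 0 0 * b 0 j)
    & (lsubmx w *m c) 0 0 <= lsubmx (rsubmx w) 0 0].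
have cone : polyhedral_cone P.
  exists (col_mx (- c) (col_mx 1%:M 0) ::
          [seq col_mx (col j A) (col_mx 0 (- b 0 j)%:M) | j <- enum 'I_p]) => w.
  rewrite -[w]hsubmxK; move: (lsubmx w) (rsubmx w) => x v.
  rewrite -[v]hsubmxK; move: (lsubmx v) (rsubmx v) => t u.
  rewrite /P !(row_mxKl, row_mxKr).
  have E1 : (row_mx x (row_mx t u) *m col_mx (- c) (col_mx 1%:M 0)) 0 0
     = t 0 0 - (x *m c) 0 0.
    by rewrite !mul_row_col mulmx1 mulmx0 addr0 mulmxN !mxE addrC.
  have E2 j : (row_mx x (row_mx t u) *m
        col_mx (col j A) (col_mx 0 (- b 0 j)%:M)) 0 0
     = (x *m A) 0 j - u 0 0 * b 0 j.
    rewrite !mul_row_col mulmx0 add0r mul_mx_scalar colE mulmxA -colE.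
    by move: (x *m A) => xA; rewrite !mxE mulNr mulrC.
  split=> [[bP cP] e|H].
    rewrite inE => /predU1P[->|/mapP[j _ ->]]; first by rewrite E1 subr_ge0.
    by rewrite E2.
  split=> [j|]; last by rewrite -subr_ge0 -E1 H ?mem_head.
  rewrite -E2 H // inE; apply/orP; right.
  apply: (map_f (fun j => col_mx (col j A) (col_mx 0 (- b 0 j)%:M))).
  by rewrite mem_enum.
have [cs csP] := polyhedral_cone_eliminate cone.
have scal00 (t : F) : (t%:M : 'M[F]_1) 0 0 = t by rewrite mxE eqxx mulr1n.
pose above (t : F) := forall e : 'cV_(1 + 1), e \in cs ->
  0 <= t * usubmx e 0 0 + dsubmx e 0 0.
have aboveP t : (exists2 x, feasible x & (x *m c) 0 0 <= t) <-> above t.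
  have := csP (row_mx t%:M 1%:M); rewrite /P => E.
  have E1 (e : 'cV_(1 + 1)) :
     (row_mx t%:M 1%:M *m e) 0 0 = t * usubmx e 0 0 + dsubmx e 0 0.
    by rewrite -[e in LHS]vsubmxK mul_row_col mul1mx mul_scalar_mx !mxE.
  split=> [[x xP xt]|H].
    move=> e; rewrite -E1; move: e; apply/E; exists x.
    rewrite !(row_mxKl, row_mxKr); split.
      by move=> j; rewrite scal00 mul1r subr_ge0.
    by rewrite scal00.
  have [x [xP xt]] : exists x, P (row_mx x (row_mx t%:M 1%:M)).
    by apply/csP => e; rewrite E1; apply: H.
  exists x; last by move: xt; rewrite !(row_mxKl, row_mxKr) scal00.
  move=> j; move: (xP j).
  by rewrite !(row_mxKl, row_mxKr) scal00 mul1r subr_ge0.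
pose bd (e : 'cV[F]_(1 + 1)) := - dsubmx e 0 0 / usubmx e 0 0.
pose t0 := (x0 *m c) 0 0.
have T0 := (aboveP t0).1 (ex_intro2 _ _ x0 x0P (lexx _)).
(* The constraints with positive t-coefficient are the lower bounds on t.  The
   known bound z is added so that their maximum makes sense even when there are
   none; being a lower bound of the projected set, z does no harm. *)
have lb t : above t ->
  forall l, l \in z :: [seq bd e | e <- cs & 0 < usubmx e 0 0] -> l <= t.
  move=> tP l; rewrite inE => /predU1P[->|/mapP[e]].
    by have [x /zP zx] := (aboveP t).2 tP; apply: le_trans.
  rewrite mem_filter => /andP[e0 /tP ep] ->.
  by rewrite ler_pdivrMr //; lra.
pose tmin := \big[Num.max/z]_(e <- cs | 0 < usubmx e 0 0) bd e.
have tmin_le t : above t -> tmin <= t.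
  move=> /lb tP; rewrite /tmin big_seq_cond.
  apply: bigmax_le => [|e /andP[ecs e0]].
    by rewrite tP ?mem_head.
  by rewrite tP // inE map_f ?orbT // mem_filter e0.
(* The remaining constraints only bound t from above, so they pass from the
   value t0 at x0 down to tmin. *)
have [|x xP xt] := (aboveP tmin).2.
  move=> e ecs; have [e0|e0] := ltP 0 (usubmx e 0 0).
    have : bd e <= tmin by apply: le_bigmax_seq.
    by rewrite ler_pdivrMr //; lra.
  have := T0 e ecs; have := tmin_le t0 T0; nra.
exists x => // y yP; apply: le_trans xt _; apply: tmin_le.
by apply/aboveP; exists y.
Qed.

(** * The rational points of a covering polyhedron *)

(** The points of Q(C) with rational coordinates, in a form that does not depend
    on a choice of real numbers. *)
Definition rat_cover (s m : nat) (C : 'M[rat]_(s, m)) (x : 'rV[rat]_s) :=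
  (forall i, 0 <= x 0 i) /\ (forall j, 1 <= (x *m C) 0 j).

Definition optimal_cover (s m : nat) (C : 'M[rat]_(s, m)) (x : 'rV[rat]_s) :=
  rat_cover C x /\ forall y, rat_cover C y -> \sum_i x 0 i <= \sum_i y 0 i.

Definition scaled_exponent (s : nat) (a : 'X_{1..s}) (n : nat) : 'rV[rat]_s :=
  \row_i ((a i)%:R / n%:R).

Lemma covering_polyhedron_ratr (R : realType) (s m : nat) (C : 'M[rat]_(s, m))
    (x : 'rV[rat]_s) :
  covering_polyhedron C (map_mx ratr x : 'rV[R]_s) <-> rat_cover C x.
Proof.
have nneg i : (0 <= (map_mx ratr x : 'rV[R]_s) 0 i) = (0 <= x 0 i).
  by rewrite mxE ler0q.
have cov j : (1 <= ((map_mx ratr x : 'rV[R]_s) *m map_mx ratr C) 0 j)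
    = (1 <= (x *m C) 0 j).
  by rewrite -map_mxM mxE -(rmorph1 (ratr : rat -> R)) ler_rat.
by split=> -[x0 x1]; split=> i; move: (x0, x1) => H;
  first [rewrite -nneg; exact: H.1 | rewrite -cov; exact: H.2
       | rewrite nneg; exact: H.1 | rewrite cov; exact: H.2].
Qed.

Lemma rat_cover_le (s m : nat) (C : 'M[rat]_(s, m)) (x y : 'rV[rat]_s) :
  (forall i j, 0 <= C i j) -> rat_cover C x ->
  (forall i, x 0 i <= y 0 i) -> rat_cover C y.
Proof.
move=> C0 [x0 x1] xy; split=> [i|j]; first exact: le_trans (x0 i) (xy i).
apply: le_trans (x1 j) _; rewrite !mxE; apply: ler_sum => i _.
exact: ler_wpM2r.
Qed.

(** A large constant vector works: a non-zero column with non-negative entries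
    has a positive sum. *)
Lemma rat_cover_nonempty (s m : nat) (C : 'M[rat]_(s, m)) :
  (forall i j, 0 <= C i j) -> (forall j, col j C != 0) ->
  exists x, rat_cover C x.
Proof.
move=> C0 Cn0; pose S j := \sum_i C i j.
have S0 j : 0 < S j.
  rewrite lt_neqAle sumr_ge0 // andbT eq_sym; apply: contra (Cn0 j) => /eqP S0.
  have /psumr_eq0P H := S0; apply/eqP/matrixP => i k.
  by rewrite !mxE H.
exists (const_mx (\sum_j (S j)^-1)); split=> [i|j].
  by rewrite mxE sumr_ge0 // => j _; rewrite invr_ge0 ltW.
rewrite mxE (eq_bigr (fun i => (\sum_j (S j)^-1) * C i j)); last first.
  by move=> i _; rewrite mxE.
rewrite -mulr_sumr (bigD1 j) //= mulrDl mulVf ?gt_eqF // lerDl mulr_ge0 //.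
  by apply: sumr_ge0 => k _; rewrite invr_ge0 ltW.
exact: ltW (S0 j).
Qed.

Lemma common_denominator (s : nat) (x : 'rV[rat]_s) : (forall i, 0 <= x 0 i) ->
  exists2 k, (0 < k)%N & exists a : 'X_{1..s}, scaled_exponent a k = x.
Proof.
move=> x0; pose D i := absz (denq (x 0 i)).
have D0 i : (0 < D i)%N by rewrite absz_gt0 denq_neq0.
pose k := (\prod_i D i)%N; have k0 : (0 < k)%N by apply: prodn_gt0.
exists k => //.
exists [multinom (absz (numq (x 0%R i)) * (k %/ D i))%N | i < s].
apply/rowP => i; rewrite mxE mnmE.
have kE : k = (D i * (k %/ D i))%N.
  by rewrite mulnC divnK // /k (bigD1 i) //= dvdn_mulr.
have e0 : (0 < k %/ D i)%N.
  by move: k0; rewrite [X in (0 < X)%N -> _]kE muln_gt0 => /andP[].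
rewrite [in X in _ / X]kE !natrM -mulf_div divff ?pnatr_eq0 -?lt0n // mulr1.
rewrite -[RHS]divq_num_den !natr_absz ger0_norm ?numq_ge0 //.
by rewrite ger0_norm // ltW // denq_gt0.
Qed.

(** The constraints x >= 0 and xC >= 1 are those of the block matrix [1 | C]. *)
Lemma optimal_cover_exists (s m : nat) (C : 'M[rat]_(s, m)) :
  (forall i j, 0 <= C i j) -> (forall j, col j C != 0) ->
  exists x, optimal_cover C x.
Proof.
move=> C0 Cn0; have [x0 x0P] := rat_cover_nonempty C0 Cn0.
pose A := row_mx 1%:M C; pose b : 'rV[rat]_(s + m) := row_mx 0 (const_mx 1).
have covE (x : 'rV_s) : rat_cover C x <-> forall j, b 0 j <= (x *m A) 0 j.
  rewrite mul_mx_row mulmx1; split=> [[xp xC] j|xA].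
    by case: (split_ordP j) => i ->; rewrite ?row_mxEl ?row_mxEr mxE.
  split=> i; first by have := xA (lshift m i); rewrite !row_mxEl mxE.
  by have := xA (rshift s i); rewrite !row_mxEr mxE.
have sumE (x : 'rV[rat]_s) : (x *m (const_mx 1 : 'cV_s)) 0 0 = \sum_i x 0 i.
  by rewrite mxE; apply: eq_bigr => i _; rewrite mxE mulr1.
have [||x xP xmin] := @linear_program_min _ _ _ A b (const_mx 1) 0 x0.
- exact/covE.
- by move=> x /covE [xp _]; rewrite sumE sumr_ge0.
exists x; split; first exact/covE.
by move=> y /covE yP; rewrite -!sumE; apply: xmin.
Qed.

(** * The monomials of the filtration and their least degree *)

(** The polynomials all of whose exponents lie in U form an ideal when U is
    closed under adding exponent vectors, and this ideal contains the given
    generators. *)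
Lemma monomial_ideal_mem (K : fieldType) (s : nat) (U : set 'X_{1..s})
    (b : 'X_{1..s}) :
  (forall a c, U a -> U (a + c)%MM) ->
  ideal_gen [set 'X_[K, a] | a in U] 'X_[b] <-> U b.
Proof.
move=> Uup; split=> [Ib|Ub I [_ AI]]; last by apply: AI; exists b.
pose J := [set p : {mpoly K[s]} | forall a, a \in msupp p -> U a].
have Jideal : is_ideal J.
  split=> [a|p q Jp Jq a /msuppD_le|p q Jq a /msuppM_le].
  - by rewrite msupp0.
  - by rewrite mem_cat => /orP[/Jp|/Jq].
  - by move=> /allpairsP[[c d] /= [_ /Jq Ud ->]]; rewrite addmC; apply: Uup.
apply: (Ib J) => //; last by rewrite msuppX inE.
split=> // _ [a Ua <-] c; rewrite msuppX inE => /eqP ->; exact: Ua.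
Qed.

Lemma filtration_monomial (R : realType) (K : fieldType) (s m : nat)
    (C : 'M[rat]_(s, m)) (n : nat) (b : 'X_{1..s}) :
  (forall i j, 0 <= C i j) -> (0 < n)%N ->
  filtration R K C n 'X_[b] <-> rat_cover C (scaled_exponent b n).
Proof.
case: n => // n C0 _; rewrite -(covering_polyhedron_ratr R).
have E a : map_mx ratr (scaled_exponent a n.+1) =
    \row_i ((a i)%:R / n.+1%:R) :> 'rV[R]_s.
  by apply/rowP => i; rewrite !mxE fmorph_div !rmorph_nat.
rewrite E; apply: monomial_ideal_mem => a c /=.
rewrite -!E !covering_polyhedron_ratr => ca; apply: rat_cover_le ca _ => // i.
by rewrite !mxE ler_pM2r ?invr_gt0 ?ltr0n // ler_nat mnmDE leq_addr.
Qed.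

Lemma alphaP (K : fieldType) (s : nat) (F : nat -> set {mpoly K[s]}) (n : nat)
    (b : 'X_{1..s}) :
  F n 'X_[b] ->
  (exists2 a, F n 'X_[a] & alpha F n = mdeg a) /\
  (forall a, F n 'X_[a] -> alpha F n <= mdeg a)%N.
Proof.
move=> Fb.
have ex : exists d, `[< monomial_degrees (F n) d >].
  by exists (mdeg b); apply/asboolP; exists b.
have [[a Fa ad] lb] : monomial_degrees (F n) (alpha F n) /\
    forall e, monomial_degrees (F n) e -> (alpha F n <= e)%N.
  apply: (xgetPex 0%N (P := [set d | monomial_degrees (F n) d /\
    forall e, monomial_degrees (F n) e -> (d <= e)%N])).
  case: (ex_minnP ex) => d /asboolP Fd dmin.
  by exists d; split=> // e Fe; apply: dmin; apply/asboolP.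
by split=> [|c Fc]; [exists a | apply: lb; exists c].
Qed.

Lemma sum_scaled_exponent (s : nat) (a : 'X_{1..s}) (n : nat) :
  \sum_i scaled_exponent a n 0 i = (mdeg a)%:R / n%:R.
Proof.
by rewrite mdegE natr_sum mulr_suml; apply: eq_bigr => i _; rewrite mxE.
Qed.

(** Optimality of x gives the lower bound.  For the upper bound, rounding each
    of the s coordinates of n x up raises the degree by at most 1 per coordinate,
    and the rounded vector stays in n Q(C) because it dominates n x. *)
Lemma alpha_bounds (R : realType) (K : fieldType) (s m : nat)
    (C : 'M[rat]_(s, m)) (x : 'rV[rat]_s) (n : nat) :
  (forall i j, 0 <= C i j) -> optimal_cover C x -> (0 < n)%N ->
  \sum_i x 0 i <= (alpha (filtration R K C) n)%:R / n%:R
     <= \sum_i x 0 i + s%:R / n%:R.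
Proof.
move=> C0 [xP xmin] n0; have n0' : 0 < n%:R :> rat by rewrite ltr0n.
pose a := [multinom absz (Num.ceil (n%:R * x 0%R i)) | i < s].
have aE i : (a i)%:R = (Num.ceil (n%:R * x 0 i))%:~R :> rat.
  rewrite mnmE natr_absz ger0_norm // ceil_ge0.
  by apply: lt_le_trans (mulr_ge0 (ltW n0') (xP.1 i)); rewrite ltrN10.
have xa i : x 0 i <= scaled_exponent a n 0 i <= x 0 i + n%:R^-1.
  rewrite mxE aE ler_pdivlMr // ler_pdivrMr // mulrDl mulVf ?gt_eqF //.
  have := ceil_itv (n%:R * x 0 i); rewrite intrB => /andP[lb ub].
  by apply/andP; split; lra.
have Fa : filtration R K C n 'X_[a].
  apply/filtration_monomial => //; apply: rat_cover_le xP _ => // i.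
  by case/andP: (xa i).
have [[b Fb ->] amin] := alphaP Fa.
apply/andP; split.
  rewrite -sum_scaled_exponent; apply: xmin.
  exact/(filtration_monomial R K).
apply: (@le_trans _ _ ((mdeg a)%:R / n%:R)).
  rewrite ler_pM2r ?invr_gt0 // ler_nat; exact: amin.
rewrite -sum_scaled_exponent.
apply: (@le_trans _ _ (\sum_i (x 0 i + n%:R^-1))).
  by apply: ler_sum => i _; case/andP: (xa i).
by rewrite big_split /= sumr_const card_ord mulr_natl.
Qed.

(** The lower bound of [alpha_bounds] is attained as soon as n x is integral. *)
Lemma alpha_of_optimal_cover (R : realType) (K : fieldType) (s m : nat)
    (C : 'M[rat]_(s, m)) (x : 'rV[rat]_s) (n : nat) (a : 'X_{1..s}) :
  (forall i j, 0 <= C i j) -> optimal_cover C x -> (0 < n)%N ->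
  scaled_exponent a n = x ->
  (alpha (filtration R K C) n)%:R / n%:R = \sum_i x 0 i.
Proof.
move=> C0 [xP xmin] n0 ax; apply/eqP; rewrite eq_le.
have /andP[-> _] := alpha_bounds R K C0 (conj xP xmin) n0; rewrite andbT.
rewrite -ax sum_scaled_exponent ler_pM2r ?invr_gt0 ?ltr0n // ler_nat.
have Fa : filtration R K C n 'X_[a].
  by apply/filtration_monomial => //; rewrite ax.
by have [_ ->] := alphaP Fa.
Qed.

Lemma waldschmidt_squeeze (R : realType) (K : fieldType) (s : nat)
    (F : nat -> set {mpoly K[s]}) (v B : R) :
  (forall n, (0 < n)%N -> v <= (alpha F n)%:R / n%:R <= v + B / n%:R) ->
  waldschmidt R F = v.
Proof.
move=> bnd; apply: cvg_lim; first exact: Rhausdorff.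
rewrite -cvg_shiftS; apply: (@squeeze_cvgr _ _ _ _ (fun=> v)
   (fun n => v + B * harmonic n)).
- by apply: nearW => n; exact: bnd.
- exact: cvg_cst.
- rewrite -[X in _ --> X]addr0 -[X in _ --> _ + X](mulr0 B).
  apply: cvgD; first exact: cvg_cst.
  by apply: cvgM; [exact: cvg_cst | exact: cvg_harmonic].
Qed.

Unset Implicit Arguments.
Set Strict Implicit.

Theorem proposition3p16 (R : realType) (K : fieldType) (s m : nat)
    (C : 'M[rat]_(s, m))
    (C_ge0 : forall i j, 0 <= C i j)
    (C_col_neq0 : forall j, col j C != 0) :
  exists k : nat, (1 <= k)%N /\
    forall n : nat, (1 <= n)%N ->
      waldschmidt R (filtration R K C) =
        (alpha (filtration R K C) (n * k)%N)%:R / (n * k)%:R.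
Proof.
have [x xopt] := optimal_cover_exists C_ge0 C_col_neq0.
have [k k0 [a ax]] := common_denominator xopt.1.1.
have -> : waldschmidt R (filtration R K C) = ratr (\sum_i x 0 i).
  apply: (waldschmidt_squeeze (B := s%:R)) => n n0.
  have := alpha_bounds R K C_ge0 xopt n0.
  by rewrite -!(ler_rat R) rmorphD /= !fmorph_div !rmorph_nat.
exists k; split=> // n n0.
have nk0 : (0 < n * k)%N by rewrite muln_gt0 n0.
rewrite -(alpha_of_optimal_cover R K (a := (a *+ n)%MM) C_ge0 xopt nk0).
  by rewrite fmorph_div !rmorph_nat.
rewrite -ax; apply/rowP => i; rewrite !mxE mulmnE mulnC !natrM -mulf_div.
by rewrite divff ?pnatr_eq0 -?lt0n // mul1r.
Qed.
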